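(* If $n,m\ge 3$, then $\mathrm{mob}(P_n\,\square\, P_m)=3$.
   Context: $P_k$ is the path on $k$ vertices and $\square$ is the Cartesian product (so $P_n\,\square\,P_m$ is the $n\times m$ grid). A set $S\subseteq V(G)$ is a general position set if no three vertices of $S$ lie on a common shortest path. Robots are placed one per vertex of a general position set $S$; a move $u\to v$ along an edge $uv$ with $u\in S$ is legal if $v\notin S$ and $(S\setminus\{u\})\cup\{v\}$ is a general position set. $S$ is a mobile general position set if some sequence of legal moves starting from $S$ visits every vertex at least once; $\mathrm{mob}(G)$ is the maximum size of a mobile general position set. *)

(* Defs.v *)
From mathcomp Require Import all_boot.
From mathcomp Require Import boolp.

Set Implicit Arguments.
Unset Strict Implicit.
Unset Printing Implicit Defensive.

Record sgraph := SGraph {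
  vertex :> finType;
  adj : rel vertex;
  adj_sym : symmetric adj;
  adj_irr : irreflexive adj
}.

Arguments adj {G} : rename.

Definition path_rel (k : nat) : rel 'I_k :=
  fun i j => (i.+1 == j :> nat) || (j.+1 == i :> nat).

Lemma path_rel_sym k : symmetric (@path_rel k).
Proof. by move=> i j; rewrite /path_rel orbC. Qed.

Lemma path_rel_irr k : irreflexive (@path_rel k).
Proof. by move=> i; rewrite /path_rel orbb gtn_eqF. Qed.

Definition path_graph (k : nat) : sgraph :=
  SGraph (@path_rel_sym k) (@path_rel_irr k).

Definition cart_rel (G H : sgraph) : rel (G * H) :=
  fun x y => ((x.1 == y.1) && adj x.2 y.2) || (adj x.1 y.1 && (x.2 == y.2)).

Lemma cart_rel_sym (G H : sgraph) : symmetric (@cart_rel G H).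
Proof.
move=> x y.
by rewrite /cart_rel (adj_sym x.1) (adj_sym x.2) (eq_sym x.1) (eq_sym x.2).
Qed.

Lemma cart_rel_irr (G H : sgraph) : irreflexive (@cart_rel G H).
Proof. by move=> x; rewrite /cart_rel !adj_irr andbF. Qed.

Definition cart_prod (G H : sgraph) : sgraph :=
  SGraph (@cart_rel_sym G H) (@cart_rel_irr G H).

Notation "G □ H" := (cart_prod G H) (at level 40, left associativity).

Section Mobile.

Variable G : sgraph.
Implicit Types (u v : G) (p q : seq G) (S : {set G}) (cs : seq {set G}).

(* As in MathComp's [path], the vertices of the walk are those of [u :: p]. *)
Definition shortest_path u p : Prop :=
  path adj u p /\
  forall q, path adj u q -> last u q = last u p -> size p <= size q.

Definition general_position S : Prop :=
  forall x y z, x \in S -> y \in S -> z \in S -> uniq [:: x; y; z] ->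
  ~ exists u p, shortest_path u p /\ {subset [:: x; y; z] <= u :: p}.

Definition move S u v : {set G} := v |: (S :\ u).

Definition legal_move S u v : Prop :=
  [/\ u \in S, adj u v, v \notin S & general_position (move S u v)].

(* The list [cs] holds the configurations reached after each move from [S]. *)
Fixpoint legal_moves S cs : Prop :=
  if cs is S' :: cs' then
    (exists u v, legal_move S u v /\ S' = move S u v) /\ legal_moves S' cs'
  else True.

(* The vertices occupied at the start count as visited. *)
Definition mobile S : Prop :=
  general_position S /\
  exists cs, legal_moves S cs /\
    forall v, exists2 C : {set G}, C \in S :: cs & v \in C.

Definition mob : nat := \max_(S : {set G} | `[< mobile S >]) #|S|.

End Mobile.

(* Main.v *)
Require Import Defs.
From mathcomp Require Import all_boot.
From mathcomp Require Import boolp zify.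

Set Implicit Arguments.
Unset Strict Implicit.
Unset Printing Implicit Defensive.

(** In the grid, three vertices lie on a common shortest path iff one of them
    lies in the bounding box of the other two.

    Upper bound: if a general position set contains the corner (0, 0), its
    other vertices are pairwise incomparable in the product order, hence form
    a strictly decreasing chain, of which no three are in general position.
    As some robot has to visit the corner, there are at most three robots.

    Lower bound: call a triple [a, b, c] of robots an arrow if [c] is strictly
    below [a], [b] strictly above [a], and both strictly to the right of [a].
    Pushing the robots apart shows that all arrows are mutually reachable, and
    by reflection the same holds for the mirrored arrows.  Two moves in a 3 x 3
    subgrid turn an arrow into a mirrored one, and every vertex belongs to an
    arrow or a mirrored arrow. *)

(** * Reachability by legal moves, in an arbitrary graph *)

Section Reachability.

Variable G : sgraph.
Implicit Types (u v : G) (S : {set G}) (cs : seq {set G}).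

Definition reach S S' : Prop :=
  exists cs, legal_moves S cs /\ last S cs = S'.

Lemma legal_moves_cat S cs1 cs2 :
  legal_moves S (cs1 ++ cs2) <->
  legal_moves S cs1 /\ legal_moves (last S cs1) cs2.
Proof.
by elim: cs1 S => [|S' cs1 IH] S /=; [tauto | rewrite IH; tauto].
Qed.

Lemma reach_refl S : reach S S.
Proof. by exists [::]. Qed.

Lemma reach_trans S1 S2 S3 : reach S1 S2 -> reach S2 S3 -> reach S1 S3.
Proof.
move=> [cs1 [l1 <-]] [cs2 [l2 <-]]; exists (cs1 ++ cs2).
by rewrite legal_moves_cat last_cat.
Qed.

Lemma legal_move_reach S u v : legal_move S u v -> reach S (move S u v).
Proof. by move=> l; exists [:: move S u v]; do !split=> //; exists u, v. Qed.

Lemma move_inv S u v : u \in S -> v \notin S -> move (move S u v) v u = S.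
Proof.
move=> uS vS; apply/setP=> w; rewrite !inE.
have [->|wu] := eqVneq w u; first by rewrite uS.
by have [->|wv] := eqVneq w v; [rewrite (negbTE vS)|].
Qed.

(** Undoing a move lands back in [S]. A legal move records general position of its target only,
    hence the hypothesis on [S]. *)
Lemma legal_move_sym S u v : general_position S ->
  legal_move S u v -> legal_move (move S u v) v u.
Proof.
move=> gS [uS uv vS _]; split; rewrite ?move_inv ?setU11 1?adj_sym //.
rewrite !inE eqxx orbF; apply: contraNneq vS => <- //.
Qed.

Lemma reach_sym S S' : general_position S -> reach S S' -> reach S' S.
Proof.
move=> gS [cs [lcs <-]]; elim: cs S gS lcs => [|T cs IH] S gS /=.
  by move=> _; exact: reach_refl.
move=> [[u [v [luv ->]]] lcs].
have [uS _ vS gT] := luv; apply: reach_trans (IH _ gT lcs) _.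
by have := legal_move_reach (legal_move_sym gS luv); rewrite move_inv.
Qed.

Lemma card_move S u v : u \in S -> v \notin S -> #|move S u v| = #|S|.
Proof.
move=> uS vS; rewrite cardsU1 !inE (negbTE vS) andbF /=.
by rewrite [in RHS](cardsD1 u) uS.
Qed.

(** Carries a cardinality bound from the configuration that visits a chosen vertex back to the
    initial one. *)
Lemma legal_moves_invariant S cs C : general_position S -> legal_moves S cs ->
  C \in S :: cs -> general_position C /\ #|C| = #|S|.
Proof.
elim: cs S => [|T cs IH] S gS /=; first by move=> _; rewrite inE => /eqP->.
move=> [[u [v [[uS _ vS gT] eT]]] lcs]; rewrite inE => /orP[/eqP-> //|CT].
rewrite -eT in gT; have [gC ->] := IH _ gT lcs CT.
by rewrite eT card_move.
Qed.

Lemma mobile_of_reach S : general_position S ->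
  (forall v, exists2 S', reach S S' & v \in S') -> mobile S.
Proof.
move=> gS cov; split=> //.
(* The tour is required to return to [S], so that round trips, one for each vertex, can be
   concatenated. *)
have [cs [lcs _ vis]] : exists cs, [/\ legal_moves S cs, last S cs = S &
    {in enum G, forall v, exists2 C, C \in S :: cs & v \in C}].
  elim: (enum G) => [|v vs [cs [lcs ecs vis]]]; first by exists [::].
  have [S' rS vS'] := cov v.
  have [bs [lbs ebs]] := reach_sym gS rS.
  have [ps [lps eps]] := rS.
  exists (ps ++ bs ++ cs); split.
  - by rewrite !legal_moves_cat eps ebs.
  - by rewrite !last_cat eps ebs.
  - move=> w; rewrite inE => /orP[/eqP->|/vis[C CS wC]].
      exists S' => //; rewrite -cat_cons mem_cat -eps mem_last //.
    exists C => //; move: CS; rewrite !inE !mem_cat.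
    by case/orP=> ->; rewrite ?orbT.
by exists cs; split=> // v; apply: vis; rewrite mem_enum.
Qed.

End Reachability.

(** * The grid in coordinates *)

Section Grid.

Variables n m : nat.

(** With successor side lengths both paths are nonempty, as [inord] requires, and [n], [m] are the
    largest coordinates. *)
Let G := path_graph n.+1 □ path_graph m.+1.
Implicit Types (p q r : G) (S : {set G}).

Definition abscissa p : nat := (p.1 : 'I_n.+1).
Definition ordinate p : nat := (p.2 : 'I_m.+1).
Local Notation X := abscissa.
Local Notation Y := ordinate.

(** [inord] sends an out-of-range coordinate to 0, so reading coordinates back requires bounds. *)
Definition grid_vertex (x y : nat) : G :=
  (inord x : path_graph n.+1, inord y : path_graph m.+1).

Lemma grid_vertexX x y : x <= n -> X (grid_vertex x y) = x.
Proof. by move=> xn; rewrite /X /= inordK. Qed.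

Lemma grid_vertexY x y : y <= m -> Y (grid_vertex x y) = y.
Proof. by move=> ym; rewrite /Y /= inordK. Qed.

Lemma X_max p : X p <= n. Proof. by rewrite -ltnS ltn_ord. Qed.
Lemma Y_max p : Y p <= m. Proof. by rewrite -ltnS ltn_ord. Qed.

Lemma grid_eqP p q : reflect (X p = X q /\ Y p = Y q) (p == q).
Proof.
apply: (iffP eqP) => [-> //|[]].
by case: p q => [a b] [c d]; rewrite /X /Y /= => /val_inj-> /val_inj->.
Qed.

Lemma grid_vertexK p : grid_vertex (X p) (Y p) = p.
Proof.
by apply/eqP/grid_eqP; rewrite grid_vertexX ?grid_vertexY ?X_max ?Y_max.
Qed.

(** * Distance in the grid *)

Lemma grid_adjE p q :
  adj p q = (X p == X q) && (((Y p).+1 == Y q) || ((Y q).+1 == Y p)) ||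
            (((X p).+1 == X q) || ((X q).+1 == X p)) && (Y p == Y q).
Proof. by []. Qed.

Definition manhattan p q : nat :=
  (X p - X q) + (X q - X p) + ((Y p - Y q) + (Y q - Y p)).

Lemma manhattan_triangle q p r : manhattan p r <= manhattan p q + manhattan q r.
Proof. by rewrite /manhattan; lia. Qed.

Lemma manhattan_adj p q : adj p q -> manhattan p q = 1.
Proof. by rewrite grid_adjE /manhattan; lia. Qed.

(** Walk horizontally until the abscissae agree, then vertically; each step lowers the distance to
    [q] by one. *)
Lemma manhattan_walk p q :
  exists s, [/\ path adj p s, last p s = q & size s = manhattan p q].
Proof.
have [k] := ubnP (manhattan p q); elim: k p => // k IH p lek.
have step p' : adj p p' -> (manhattan p' q).+1 = manhattan p q ->
    exists s, [/\ path adj p s, last p s = q & size s = manhattan p q].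
  move=> pp' e; have /IH[s [ps ls ss]] : manhattan p' q < k by lia.
  by exists (p' :: s); split; [apply/andP | | rewrite -e -ss].
have Xp := X_max p; have Yp := Y_max p.
have Xq := X_max q; have Yq := Y_max q.
have [lt|gt|eX] := ltngtP (X p) (X q).
- apply: (step (grid_vertex (X p).+1 (Y p)));
    rewrite ?grid_adjE /manhattan ?grid_vertexX ?grid_vertexY //; lia.
- apply: (step (grid_vertex (X p).-1 (Y p)));
    rewrite ?grid_adjE /manhattan ?grid_vertexX ?grid_vertexY //; lia.
have [lt|gt|eY] := ltngtP (Y p) (Y q).
- apply: (step (grid_vertex (X p) (Y p).+1));
    rewrite ?grid_adjE /manhattan ?grid_vertexX ?grid_vertexY //; lia.
- apply: (step (grid_vertex (X p) (Y p).-1));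
    rewrite ?grid_adjE /manhattan ?grid_vertexX ?grid_vertexY //; lia.
exists [::]; split=> //; first by apply/eqP/grid_eqP.
by rewrite /manhattan eX eY !subnn.
Qed.

Lemma manhattan_path u s i j : path adj u s -> i <= j <= size s ->
  manhattan (nth u (u :: s) i) (nth u (u :: s) j) <= j - i.
Proof.
move=> us /andP[]; elim: j => [|j IH].
  by case: i => // *; rewrite /manhattan; lia.
rewrite leq_eqVlt => /orP[/eqP<- _|ij js]; first by rewrite /manhattan; lia.
have := manhattan_triangle (nth u (u :: s) j) (nth u (u :: s) i)
  (nth u (u :: s) j.+1).
have e : manhattan (nth u (u :: s) j) (nth u (u :: s) j.+1) = 1.
  exact: manhattan_adj (elimT (pathP u) us j js).
by have := IH ij (ltnW js); lia.
Qed.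

Lemma manhattan_path_last u s :
  path adj u s -> manhattan u (last u s) <= size s.
Proof.
move=> us; have := @manhattan_path u s 0 (size s) us.
by rewrite leqnn subn0 /= (last_nth u); apply.
Qed.

(** * Shortest paths and general position *)

(** The pieces before [i], between [i] and [j], and after [j] span at most [i], [j - i] and
    [size s - j]. By minimality the endpoints are at least [size s] apart, so none of these bounds
    is slack. *)
Lemma shortest_path_manhattan u s i j : shortest_path u s ->
  i <= j <= size s ->
  manhattan (nth u (u :: s) i) (nth u (u :: s) j) = j - i.
Proof.
move=> [us min] ij.
have [s' [us' ls' ss']] := manhattan_walk u (last u s).
have le := min s' us' ls'.
have h1 := manhattan_path us ij.
have h2 : manhattan u (nth u (u :: s) i) <= i.
  by have := @manhattan_path u s 0 i us; rewrite subn0; apply; lia.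
have h3 : manhattan (nth u (u :: s) j) (last u s) <= size s - j.
  by rewrite (last_nth u); apply: manhattan_path us _; lia.
have := manhattan_triangle (nth u (u :: s) i) u (last u s).
have := manhattan_triangle (nth u (u :: s) j) (nth u (u :: s) i) (last u s).
by lia.
Qed.

Lemma shortest_path_additive u s p q r : shortest_path u s ->
  {subset [:: p; q; r] <= u :: s} ->
  exists p' q' r', [/\ perm_eq [:: p'; q'; r'] [:: p; q; r] &
    manhattan p' r' = manhattan p' q' + manhattan q' r'].
Proof.
move=> sp sub.
have get w : w \in [:: p; q; r] ->
    exists2 i, i <= size s & nth u (u :: s) i = w.
  by move=> /sub /(nthP u)[i]; exists i.
have [i1 l1 e1] := get p (mem_head _ _).
have [i2 l2 e2] : exists2 i, i <= size s & nth u (u :: s) i = q.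
  by apply: get; rewrite !inE eqxx orbT.
have [i3 l3 e3] : exists2 i, i <= size s & nth u (u :: s) i = r.
  by apply: get; rewrite !inE eqxx !orbT.
have add a b c : a <= b -> b <= c -> c <= size s ->
  manhattan (nth u (u :: s) a) (nth u (u :: s) c) =
  manhattan (nth u (u :: s) a) (nth u (u :: s) b) +
  manhattan (nth u (u :: s) b) (nth u (u :: s) c).
  by move=> ab bc cs; rewrite !(shortest_path_manhattan sp); lia.
have perms : [/\ perm_eq [:: p; r; q] [:: p; q; r],
    perm_eq [:: q; p; r] [:: p; q; r], perm_eq [:: q; r; p] [:: p; q; r],
    perm_eq [:: r; p; q] [:: p; q; r] & perm_eq [:: r; q; p] [:: p; q; r]].
  by split; apply/permP=> a /=; lia.
case: perms => P1 P2 P3 P4 P5.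
(* Six of the eight sign patterns are the orders of the positions on the path; the other two are
   cyclic and contradictory. *)
have [h12|h12] := leqP i1 i2; have [h23|h23] := leqP i2 i3;
  have [h13|h13] := leqP i1 i3.
- by exists p, q, r; split=> //; rewrite -e1 -e2 -e3; apply: add; lia.
- by lia.
- by exists p, r, q; split=> //; rewrite -e1 -e2 -e3; apply: add; lia.
- by exists r, p, q; split=> //; rewrite -e1 -e2 -e3; apply: add; lia.
- by exists q, p, r; split=> //; rewrite -e1 -e2 -e3; apply: add; lia.
- by exists q, r, p; split=> //; rewrite -e1 -e2 -e3; apply: add; lia.
- by lia.
- by exists r, q, p; split=> //; rewrite -e1 -e2 -e3; apply: add; lia.
Qed.

(** If the distances add up, joining two walks of minimal length at [q] gives a shortest path.
    Conversely, the order along a shortest path singles out a middle vertex. *)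
Lemma general_positionE S : general_position S <->
  forall p q r, p \in S -> q \in S -> r \in S -> uniq [:: p; q; r] ->
  manhattan p r <> manhattan p q + manhattan q r.
Proof.
split=> [gS p q r pS qS rS u e|gS p q r pS qS rS u [w [s [sp sub]]]].
  apply: (gS p q r pS qS rS u); exists p.
  have [s1 [p1 l1 z1]] := manhattan_walk p q.
  have [s2 [p2 l2 z2]] := manhattan_walk q r.
  exists (s1 ++ s2); split; first split.
  - by rewrite cat_path p1 l1.
  - move=> s ps; rewrite last_cat l1 l2 size_cat z1 z2 -e => <-.
    exact: manhattan_path_last.
  move=> w; rewrite mem_seq3 => /or3P[] /eqP->; first by rewrite mem_head.
    by rewrite -cat_cons mem_cat -l1 mem_last.
  by rewrite -l2 -l1 -last_cat mem_last.
have [p' [q' [r' [eqp e]]]] := shortest_path_additive sp sub.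
have inS w' : w' \in [:: p'; q'; r'] -> w' \in S.
  by rewrite (perm_mem eqp) !inE => /or3P[] /eqP->.
apply: (gS p' q' r' _ _ _ _ e); last by rewrite (perm_uniq eqp).
- by apply: inS; rewrite mem_head.
- by apply: inS; rewrite !inE eqxx orbT.
- by apply: inS; rewrite !inE eqxx !orbT.
Qed.

(** * Upper bound at a corner *)

Lemma corner_card_le3 S :
  general_position S -> grid_vertex 0 0 \in S -> #|S| <= 3.
Proof.
move=> /general_positionE gS oS; set o := grid_vertex 0 0 in oS.
rewrite (cardsD1 o) oS add1n ltnS leqNgt; apply/negP.
have Xo : X o = 0 by rewrite grid_vertexX.
have Yo : Y o = 0 by rewrite grid_vertexY.
(* The distance from [o] is the sum of the coordinates, so of two comparable vertices the lower one
   lies between [o] and the other. *)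
have antichain p q : p \in S :\ o -> q \in S :\ o -> p != q ->
    X p < X q /\ Y q < Y p \/ X q < X p /\ Y p < Y q.
  rewrite !inE => /andP[po pS] /andP[qo qS] pq.
  have h1 := gS o p q oS pS qS; have h2 := gS o q p oS qS pS.
  rewrite /= !inE !negb_or ![o == _]eq_sym po qo pq in h1.
  rewrite /= !inE !negb_or ![o == _]eq_sym po qo [q == p]eq_sym pq in h2.
  move: (h1 isT) (h2 isT); rewrite /manhattan Xo Yo.
  by lia.
(* The middle vertex of a decreasing chain lies in the box of its ends. *)
have chain p q r : p \in S :\ o -> q \in S :\ o -> r \in S :\ o ->
    X p < X q < X r -> ~ (Y r < Y q < Y p).
  rewrite !inE => /andP[_ pS] /andP[_ qS] /andP[_ rS] hX hY.
  apply: (gS p q r pS qS rS); last by rewrite /manhattan; lia.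
  rewrite /= !inE negb_or andbT -andbA.
  by apply/and3P; split; apply/grid_eqP; lia.
move=> /card_gt2P[p [q [r [[pS qS rS] [pq qr rp]]]]].
have h1 := antichain p q pS qS pq; have h2 := antichain q r qS rS qr.
have h3 := antichain r p rS pS rp.
(* The antichain property makes the abscissae distinct; one instance is needed for each of their six
   orders. *)
have := chain p q r pS qS rS; have := chain p r q pS rS qS.
have := chain q p r qS pS rS; have := chain q r p qS rS pS.
have := chain r p q rS pS qS; have := chain r q p rS qS pS.
by lia.
Qed.

(** * Triples in general position *)

(** The negation of [manhattan q r = manhattan q p + manhattan p r], as linear inequalities between
    coordinates. *)
Definition outside_box p q r : bool :=
  [|| (X p < X q) && (X p < X r), (X q < X p) && (X r < X p),
      (Y p < Y q) && (Y p < Y r) | (Y q < Y p) && (Y r < Y p)].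

Definition spread p q r : bool :=
  [&& outside_box p q r, outside_box q p r & outside_box r p q].

(** A vertex always lies in a box of which it is a corner. *)
Lemma spread_neq p q r : spread p q r -> [/\ p != q, p != r & q != r].
Proof.
move=> h; split; apply/negP=> /eqP e; move: h; rewrite e /spread /outside_box;
  lia.
Qed.

Lemma spread_general_position p q r :
  spread p q r -> general_position [set p; q; r].
Proof.
move=> h; apply/general_positionE => a b c.
have e w : w \in [set p; q; r] -> [\/ w = p, w = q | w = r].
  rewrite !inE -orbA => /or3P[] /eqP->;
    [exact: Or31 | exact: Or32 | exact: Or33].
move=> /e ha /e hb /e hc; rewrite /= !inE negb_or andbT.
move: h ha hb hc; rewrite /spread /outside_box.
by move=> h [] -> [] -> [] ->; rewrite ?eqxx ?andbF //= => _;
  rewrite /manhattan; lia.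
Qed.

Lemma card_spread p q r : spread p q r -> #|[set p; q; r]| = 3.
Proof.
move=> /spread_neq[pq pr qr].
by rewrite setUC cardsU1 cards2 pq !inE negb_or ![r == _]eq_sym pr qr.
Qed.

(** Moves the robot listed first; [set3_swap] and [set3_rot] bring the others to the front. *)
Lemma spread_reach p p' q r : spread p q r -> spread p' q r -> adj p p' ->
  reach [set p; q; r] [set p'; q; r].
Proof.
move=> h h' pp'; have [pq pr _] := spread_neq h.
have [p'q p'r _] := spread_neq h'.
have p'p : p' != p by apply: contraTneq pp' => ->; rewrite adj_irr.
have e : move [set p; q; r] p p' = [set p'; q; r].
  apply/setP=> w; rewrite !inE; have [->|wp] := eqVneq w p; last first.
    by rewrite /= orbA.
  by rewrite (negbTE pq) (negbTE pr) !orbF.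
rewrite -e; apply: legal_move_reach; split=> //.
- by rewrite !inE eqxx.
- by rewrite !inE !negb_or p'p p'q p'r.
- by rewrite e; apply: spread_general_position.
Qed.

Lemma set3_swap p q r : [set p; q; r] = [set q; p; r].
Proof. by rewrite (setUC [set p]). Qed.

Lemma set3_rot p q r : [set p; q; r] = [set r; p; q].
Proof. by rewrite setUC setUA. Qed.

(** * Arrows and mirrored arrows *)

(* [flip] selects the mirrored orientation. *)
Definition oriented_vertex (flip : bool) (p : nat * nat) : G :=
  grid_vertex (if flip then n - p.1 else p.1) p.2.

(** Stated on coordinates before reflection, so that one predicate serves both orientations. *)
Definition arrow (a b c : nat * nat) : bool :=
  [&& c.2 < a.2 < b.2, b.2 <= m, a.1 < b.1 <= n & a.1 < c.1 <= n].

Definition arrow_set flip (a b c : nat * nat) : {set G} :=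
  [set oriented_vertex flip a; oriented_vertex flip b; oriented_vertex flip c].

Lemma oriented_vertexX flip (p : nat * nat) : p.1 <= n ->
  X (oriented_vertex flip p) = if flip then n - p.1 else p.1.
Proof. by move=> h; rewrite grid_vertexX //; case: flip; lia. Qed.

Lemma oriented_vertexY flip (p : nat * nat) :
  p.2 <= m -> Y (oriented_vertex flip p) = p.2.
Proof. exact: grid_vertexY. Qed.

Lemma oriented_vertex_adj flip (p q : nat * nat) :
  p.1 <= n -> q.1 <= n -> p.2 <= m -> q.2 <= m ->
  (p.1 == q.1) && ((p.2.+1 == q.2) || (q.2.+1 == p.2)) ||
  ((p.1.+1 == q.1) || (q.1.+1 == p.1)) && (p.2 == q.2) ->
  adj (oriented_vertex flip p) (oriented_vertex flip q).
Proof.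
move=> *; rewrite grid_adjE !oriented_vertexX ?oriented_vertexY //.
by case: flip; lia.
Qed.

(** [a] is strictly to one side of the other two, [b] strictly above them and [c] strictly below
    them. *)
Lemma arrow_spread flip a b c : arrow a b c ->
  spread (oriented_vertex flip a) (oriented_vertex flip b)
         (oriented_vertex flip c).
Proof.
rewrite /arrow => h; rewrite /spread /outside_box.
rewrite !oriented_vertexX ?oriented_vertexY; try lia.
by case: flip; lia.
Qed.

Lemma arrow_reach_extreme flip a b c : arrow a b c ->
  reach (arrow_set flip a b c) (arrow_set flip (0, 1) (n, m) (n, 0)).
Proof.
(* This potential falls whenever [a] goes left or down, [b] right or up, or [c] right or down. *)
pose dist (a b c : nat * nat) :=
  a.1 + a.2 + (n - b.1) + (m - b.2) + (n - c.1) + c.2.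
have [k] := ubnP (dist a b c); elim: k a b c => // k IH a b c lek abc.
have stepA a' : dist a' b c < dist a b c -> arrow a' b c ->
    adj (oriented_vertex flip a) (oriented_vertex flip a') ->
    reach (arrow_set flip a b c) (arrow_set flip (0, 1) (n, m) (n, 0)).
  move=> lt abc' aa'; apply: reach_trans (IH a' b c _ abc'); last by lia.
  by apply: spread_reach aa'; apply: arrow_spread.
have stepB b' : dist a b' c < dist a b c -> arrow a b' c ->
    adj (oriented_vertex flip b) (oriented_vertex flip b') ->
    reach (arrow_set flip a b c) (arrow_set flip (0, 1) (n, m) (n, 0)).
  move=> lt abc' bb'; apply: reach_trans (IH a b' c _ abc'); last by lia.
  rewrite /arrow_set !(set3_swap (oriented_vertex flip a)).
  apply: spread_reach bb'.
    by have := arrow_spread flip abc; rewrite /spread /outside_box; lia.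
  by have := arrow_spread flip abc'; rewrite /spread /outside_box; lia.
have stepC c' : dist a b c' < dist a b c -> arrow a b c' ->
    adj (oriented_vertex flip c) (oriented_vertex flip c') ->
    reach (arrow_set flip a b c) (arrow_set flip (0, 1) (n, m) (n, 0)).
  move=> lt abc' cc'; apply: reach_trans (IH a b c' _ abc'); last by lia.
  rewrite /arrow_set !(set3_rot (oriented_vertex flip a)).
  apply: spread_reach cc'.
    by have := arrow_spread flip abc; rewrite /spread /outside_box; lia.
  by have := arrow_spread flip abc'; rewrite /spread /outside_box; lia.
case: a b c => [a1 a2] [b1 b2] [c1 c2] in abc stepA stepB stepC {lek IH} *.
rewrite /arrow /dist /= in abc stepA stepB stepC.
have [h|h] := ltnP 0 a1.
  by apply: (stepA (a1.-1, a2)) => /=; [lia..|];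
    apply: oriented_vertex_adj => /=; lia.
have [h'|h'] := ltnP b1 n.
  by apply: (stepB (b1.+1, b2)) => /=; [lia..|];
    apply: oriented_vertex_adj => /=; lia.
have [h2|h2] := ltnP b2 m.
  by apply: (stepB (b1, b2.+1)) => /=; [lia..|];
    apply: oriented_vertex_adj => /=; lia.
have [h3|h3] := ltnP c1 n.
  by apply: (stepC (c1.+1, c2)) => /=; [lia..|];
    apply: oriented_vertex_adj => /=; lia.
have [h4|h4] := ltnP 0 c2.
  by apply: (stepC (c1, c2.-1)) => /=; [lia..|];
    apply: oriented_vertex_adj => /=; lia.
(* [a] is lowered last: [c] is now at ordinate 0, so [a] stays above it. *)
have [h5|h5] := ltnP 1 a2.
  by apply: (stepA (a1, a2.-1)) => /=; [lia..|];
    apply: oriented_vertex_adj => /=; lia.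
have -> : a1 = 0 by lia.
have -> : a2 = 1 by lia.
have -> : b1 = n by lia.
have -> : b2 = m by lia.
have -> : c1 = n by lia.
have -> : c2 = 0 by lia.
exact: reach_refl.
Qed.

(** Moves are reversible, so both arrows connect through the extreme one. *)
Lemma arrow_reach flip a b c a' b' c' : arrow a b c -> arrow a' b' c' ->
  reach (arrow_set flip a b c) (arrow_set flip a' b' c').
Proof.
move=> abc abc'; apply: reach_trans (arrow_reach_extreme flip abc) _.
apply: reach_sym (arrow_reach_extreme flip abc').
exact/spread_general_position/arrow_spread.
Qed.

(** * Turning arrows and covering the grid *)

Hypotheses (n_ge2 : 2 <= n) (m_ge2 : 2 <= m).

Lemma arrow_turn : reach (arrow_set false (0, 1) (2, 2) (1, 0))
                         (arrow_set true (n - 2, 1) (n, 2) (n - 1, 0)).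
Proof.
rewrite /arrow_set /oriented_vertex /= !subKn ?subnn //; last by lia.
set c := grid_vertex 1 0.
(* The left robot rises from (0, 1) to (0, 2), level with the right one, which then drops from (2,
   2) to (2, 1). The robot at (1, 0) stays below both. *)
apply: (@reach_trans _ _ [set grid_vertex 0 2; grid_vertex 2 2; c]).
  by apply: spread_reach; rewrite ?grid_adjE /spread /outside_box
    ?grid_vertexX ?grid_vertexY //; lia.
rewrite (set3_swap (grid_vertex 0 2)).
by apply: spread_reach; rewrite ?grid_adjE /spread /outside_box
  ?grid_vertexX ?grid_vertexY //; lia.
Qed.

Lemma arrow_cover (v : G) : exists flip a b c,
  arrow a b c /\ v \in arrow_set flip a b c.
Proof.
have Xv := X_max v; have Yv := Y_max v.
have vE flip :
    v = oriented_vertex flip (if flip then n - X v else X v, Y v).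
  by rewrite /oriented_vertex; case: flip; rewrite /= ?subKn ?grid_vertexK.
(* [v] plays [c] at ordinate 0, [b] above ordinate 1 and [a] at ordinate 1. Mirroring is used only
   in the column where that role is impossible: 0 for [b] and [c], [n] for [a]. *)
have [Y0|Y1|Y1] := ltngtP (Y v) 1.
- exists (X v == 0), (0, 1), (n, m), (if X v == 0 then n - X v else X v, Y v).
  by split; [rewrite /arrow /=; case: eqP; lia | rewrite !inE -vE eqxx !orbT].
- exists (X v == 0), (0, 1), (if X v == 0 then n - X v else X v, Y v), (n, 0).
  by split; [rewrite /arrow /=; case: eqP; lia | rewrite !inE -vE eqxx !orbT].
- exists (X v == n), (if X v == n then n - X v else X v, Y v), (n, m), (n, 0).
  by split; [rewrite /arrow /=; case: eqP; lia | rewrite !inE -vE eqxx].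
Qed.

Lemma arrow_mobile : mobile (arrow_set false (0, 1) (2, 2) (1, 0)).
Proof.
have arr0 : arrow (0, 1) (2, 2) (1, 0) by rewrite /arrow /=; lia.
apply: mobile_of_reach; first exact/spread_general_position/arrow_spread.
move=> v; have [[] [a [b [c [abc vabc]]]]] := arrow_cover v.
  exists (arrow_set true a b c) => //; apply: reach_trans arrow_turn _.
  by apply: arrow_reach => //; rewrite /arrow /=; lia.
by exists (arrow_set false a b c) => //; apply: arrow_reach.
Qed.

Lemma mob_grid : mob G = 3.
Proof.
apply/eqP; rewrite eqn_leq; apply/andP; split.
  apply/bigmax_leqP=> S /asboolP[gS [cs [lcs vis]]].
  have [C CS oC] := vis (grid_vertex 0 0).
  have [gC <-] := legal_moves_invariant gS lcs CS.
  exact: corner_card_le3.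
rewrite -(card_spread (arrow_spread false (a := (0, 1)) (b := (2, 2))
  (c := (1, 0)) _)); last by rewrite /arrow /=; lia.
apply: (leq_bigmax_cond (F := fun S : {set G} => #|S|)).
exact/asboolP/arrow_mobile.
Qed.

End Grid.

Theorem theorem3p2 (n m : nat) (hn : 3 <= n) (hm : 3 <= m) :
  mob (path_graph n □ path_graph m) = 3.
Proof. by case: n m hn hm => [|n] [|m] // hn hm; apply: mob_grid. Qed.
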